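(* Let $p\in[1,\infty)$ and assume that $E_p(x_0)<\infty$ for some $x_0\in\mathcal{X}$. Let $(X_n)_{n\in\mathbb{N}}$ be a Wasserstein contractive Markov chain with transition kernel $P$ and unique invariant distribution $\pi$. Additionally assume that $\int_{\mathcal{X}}|E_1(x)|^{p_0}\,\pi(dx)<\infty$ for some $p_0\in[1,\infty)$. Then for every $f\in\mathscr{L}_0$ the space $\mathscr{L}_0$ contains exactly one solution $u=u_f$ of Poisson's equation with forcing function $f$, i.e. exactly one $u\in\mathscr{L}_0$ with $u(x)-Pu(x)=f(x)-\pi(f)$ for all $x\in\mathcal{X}$ (where $\pi(f)=0$), and this $u$ satisfies $\|u\|_d\le\Lambda\|f\|_d$, $\int_{\mathcal{X}}|u(x)|^p\,\pi(dx)\le 2^p\inf_{y\in\mathcal{X}}(|u(y)|^p+\|u\|_d^pE_p(y))<\infty$, and additionally $$\int_{\mathcal{X}}|u(x)|^{p_0}\,\pi(dx)\le\left(\Lambda\,\|f\|_d\right)^{p_0}\int_{\mathcal{X}}|E_1(x)|^{p_0}\,\pi(dx).$$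
   Context: $(\mathcal{X},\rho)$ is a non-trivial (more than one point) Polish space with Borel $\sigma$-algebra $\mathcal{B}(\mathcal{X})$, and $d:\mathcal{X}\times\mathcal{X}\to[0,\infty)$ is a metric that is lower semi-continuous with respect to the product topology induced by $\rho$. For probability measures $\mu_1,\mu_2$ on $\mathcal{X}$, $\mathcal{W}(\mu_1,\mu_2)=\inf_{\eta}\int d(x,y)\,\eta(dx,dy)\in[0,\infty]$, the infimum running over all couplings $\eta$ of $\mu_1,\mu_2$. For a Markov kernel $K$ on $\mathcal{X}$, $\tau(K)=\sup_{x\ne y}\mathcal{W}(K(x,\cdot),K(y,\cdot))/d(x,y)$, and $Kf(x)=\int f(x')K(x,dx')$; $K^n$ is the $n$-th iterate, $K^0$ the identity kernel. A Markov chain with transition kernel $P$ is Wasserstein contractive if $\tau(P)<\infty$ and $\tau(P^m)<1$ for some $m\in\mathbb{N}=\{1,2,\dots\}$; in that case $\Lambda:=\sum_{n=0}^\infty\tau(P^n)<\infty$. $\pi(f)=\int f\,d\pi$. A function $f:\mathcal{X}\to\mathbb{R}$ is Lipschitz (w.r.t. $d$) if $\|f\|_d:=\sup_{x\neq y}|f(x)-f(y)|/d(x,y)<\infty$. $\mathscr{L}$ is the space of all measurable Lipschitz functions $f:\mathcal{X}\to\mathbb{R}$, and $\mathscr{L}_0=\{f\in\mathscr{L}:\pi(f)=0\}$. The $p$-eccentricity is $E_p(x)=\int_{\mathcal{X}}d(x,y)^p\,\pi(dy)\in[0,\infty]$. (Under the assumption $E_p(x_0)<\infty$ every $f\in\mathscr{L}$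 is $\pi$-integrable.) *)

(* Defs.v *)
From HB Require Import structures.
From mathcomp Require Import all_boot all_order all_algebra.
From mathcomp Require Import all_classical all_reals all_analysis.

Set Implicit Arguments.
Unset Strict Implicit.
Unset Printing Implicit Defensive.

Import Order.TTheory GRing.Theory Num.Theory.
Import numFieldNormedType.Exports.

Local Open Scope classical_set_scope.
Local Open Scope ring_scope.
Local Open Scope ereal_scope.

HB.mixin Record isPolish (disp : measure_display) (R : realType) T
    & Measurable disp T & Metric R T & Complete T := {
  separable : exists2 S : set T, countable S & dense S ;
  borelE : @measurable disp T = <<s @open T >>
}.

(* A complete separable metric space with its Borel sigma-algebra.  The
   library's measurable types are pointed, so nonemptiness is built in. *)
#[short(type="polishType")]
HB.structure Definition Polish (disp : measure_display) (R : realType) :=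
  { T of Measurable disp T & Metric R T & Complete T & isPolish disp R T }.

Definition is_metric (R : realType) (X : Type) (dist : X -> X -> R) : Prop :=
  [/\ forall x y, (0 <= dist x y)%R,
      forall x y, dist x y = 0%R <-> x = y,
      forall x y, dist x y = dist y x &
      forall x y z, (dist x z <= dist x y + dist y z)%R].

Lemma kcomp_noparam_setT (disp : measure_display) (X : measurableType disp)
    (R : realType) (k1 k2 : R.-pker X ~> X) x :
  mkcomp_noparam k1 k2 x [set: X] = 1.
Proof.
rewrite /mkcomp_noparam/= /kcomp_noparam.
under eq_integral do rewrite prob_kernel.
by rewrite integral_cst// mul1e prob_kernel.
Qed.

Section kernel_iterates.
Context (disp : measure_display) (X : measurableType disp) (R : realType).

HB.instance Definition _ (k1 k2 : R.-pker X ~> X) :=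
  isProbabilityKernel.Build _ _ X X R (mkcomp_noparam k1 k2)
    (kcomp_noparam_setT k1 k2).

Fixpoint kiter (K : R.-pker X ~> X) (n : nat) : R.-pker X ~> X :=
  if n is n'.+1 then mkcomp_noparam K (kiter K n')
  else kdirac (@measurable_id _ X setT).

Definition kapply (K : R.-pker X ~> X) (f : X -> R) (x : X) : \bar R :=
  \int[K x]_y (f y)%:E.

Definition invariant (K : R.-pker X ~> X) (mu : probability X R) : Prop :=
  forall A, measurable A -> \int[mu]_x K x A = mu A.

Definition unique_invariant (K : R.-pker X ~> X) (mu : probability X R) :=
  invariant K mu /\
  forall nu : probability X R, invariant K nu ->
    forall A, measurable A -> nu A = mu A.

(* An extended-real equation.  For measurable u and mu-integrable f its
   right-hand side is finite, so it forces u to be (K x)-integrable for every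
   x and then reads as an identity between real numbers. *)
Definition poisson_solution (K : R.-pker X ~> X) (mu : probability X R)
    (f u : X -> R) : Prop :=
  forall x, (u x)%:E - kapply K u x = (f x)%:E - \int[mu]_y (f y)%:E.

End kernel_iterates.

Section wasserstein.
Context (disp : measure_display) (X : measurableType disp) (R : realType).
Variable dist : X -> X -> R.

Definition coupling (mu nu : {measure set X -> \bar R})
    (eta : probability (X * X)%type R) : Prop :=
  forall A, measurable A ->
    eta (fst @^-1` A) = mu A /\ eta (snd @^-1` A) = nu A.

Definition wasserstein (mu nu : {measure set X -> \bar R}) : \bar R :=
  ereal_inf [set \int[eta]_z (dist z.1 z.2)%:E | eta in coupling mu nu].

Definition tau (K : R.-pker X ~> X) : \bar R :=
  ereal_sup [set wasserstein (K z.1) (K z.2) / (dist z.1 z.2)%:E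
            | z in [set z : X * X | z.1 <> z.2]].

Definition wasserstein_contractive (K : R.-pker X ~> X) : Prop :=
  tau K < +oo /\ exists m : nat, (0 < m)%N /\ tau (kiter K m) < 1.

(* Lambda, lip_norm and eccentricity take their values in \bar R, where
   0 * +oo = 0. *)
Definition Lambda (K : R.-pker X ~> X) : \bar R :=
  \sum_(0 <= n <oo) tau (kiter K n).

Definition lip_norm (f : X -> R) : \bar R :=
  ereal_sup [set (`|f z.1 - f z.2| / dist z.1 z.2)%R%:E
            | z in [set z : X * X | z.1 <> z.2]].

Definition lip_space : set (X -> R) :=
  [set f | measurable_fun [set: X] f /\ lip_norm f < +oo].

Definition lip_space0 (mu : probability X R) : set (X -> R) :=
  [set f | lip_space f /\ \int[mu]_x (f x)%:E = 0].

Definition eccentricity (mu : probability X R) (p : R) (x : X) : \bar R :=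
  \int[mu]_y (dist x y `^ p)%R%:E.

End wasserstein.

(* Main.v *)
Require Import Defs.
From mathcomp Require Import all_boot all_order all_algebra.
From mathcomp Require Import all_classical all_reals all_analysis.
From mathcomp Require Import measurable_realfun ring.

Set Implicit Arguments.
Unset Strict Implicit.
Unset Printing Implicit Defensive.

Import Order.TTheory GRing.Theory Num.Theory.
Import numFieldNormedType.Exports.

Local Open Scope classical_set_scope.
Local Open Scope ring_scope.
Local Open Scope ereal_scope.

(** Poisson's equation [u - Pu = f] is the fixed point equation of the map
    [u |-> f + Pu], and the theorem is Banach's fixed point theorem for an
    iterate of this map on the centred Lipschitz functions.

    Integrating a Lipschitz function against an almost optimal coupling shows
    that [P^n] multiplies Lipschitz constants by at most [tau (P^n)]
    ([kernel_lip]).  Bounds of this dual form are multiplicative under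
    composition of operators, which makes them convenient for powers of [P].
    Contractivity says that some power [P^m] multiplies Lipschitz constants by
    some [kappa < 1].  On functions of mean zero a Lipschitz constant [L]
    controls the values: [|h x| <= L * E_1(x)] ([centered_bound]).  The [m]-th
    iterate of [u |-> f + Pu] is affine with linear part [P^m], hence its
    iterates started at [0] are Cauchy at each point at a geometric rate, with
    the weight [E_1]; their limit is the only fixed point
    ([contraction_fixed_exists], [contraction_fixed_unique]).  The map commutes
    with its own iterates, so uniqueness makes this point a fixed point of the
    map itself, i.e. a solution ([poisson_exists], [poisson_unique]).

    For the Lipschitz norm, unfold [u = sum_(n < N) P^n f + P^N u] along the
    multiples [N = k m]: the sum has Lipschitz constant at most
    [Lambda * L], and the remainder at most [kappa ^ k] times that of [u]
    ([poisson_lip]).  The two moment bounds integrate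
    [|u x| <= |u y| + L * d (y, x)] and [|u x| <= L * E_1(x)].

    Two preliminaries make these integrals meaningful.  The cost [d] is
    measurable for the product sigma-algebra, as open sets of a product of
    separable metric spaces are countable unions of boxes
    ([open_measurable_prod]).  Lipschitz functions are integrable for every
    [P x]: by invariance of [mu] this holds for one point, and couplings of
    finite cost carry it to all others ([kernel_first_moment]). *)

(** * Borel sets of a product of Polish spaces *)

Section polish_product.
Context (disp : measure_display) (R : realType) (X : polishType disp R).

Lemma metric_ball_open (x : X) (e : R) : open (ball x e : set X).
Proof.
rewrite openE => y; rewrite ballEmdist/= => xy.
apply/nbhs_ballP; exists (e - mdist x y)%R => /=; first by rewrite subr_gt0.
move=> z; rewrite ballEmdist/= => yz.
by rewrite (le_lt_trans (metric_triangle _ y _))// -ltrBrDl.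
Qed.

Lemma metric_ball_measurable (x : X) (e : R) : measurable (ball x e : set X).
Proof.
by rewrite borelE; apply: sub_sigma_algebra; exact: metric_ball_open.
Qed.

(** Separability writes an open set as the union of the boxes contained in it
    whose centres lie in a countable dense set and whose radius is the inverse
    of a positive integer. *)
Lemma open_measurable_prod (O : set (X * X)) : open O -> measurable O.
Proof.
move=> oO.
have [S cS dS] := @separable disp R X.
pose r (n : nat) : R := n.+1%:R^-1%R.
have r0 n : (0 < r n)%R by rewrite invr_gt0 ltr0Sn.
have near_S (x : X) n : exists2 s, S s & ball s (r n) x.
  have [s [xs Ss]] : ball x (r n) `&` S !=set0.
    by apply: dS; [exists x; exact: ballxx|exact: metric_ball_open].
  by exists s => //; exact: ball_sym.
pose box (i : X * X * nat) : set (X * X) :=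
  ball i.1.1 (r i.2) `*` ball i.1.2 (r i.2).
pose I := [set i : X * X * nat | [/\ S i.1.1, S i.1.2 & box i `<=` O]].
have cI : countable I.
  apply: (@sub_countable _ _ _ ((S `*` S) `*` [set: nat])).
    by apply: subset_card_le => -[[x y] n] [].
  by apply: countableX => //; exact: countableX.
have -> : O = \bigcup_(i in I) box i.
  apply/seteqP; split => [[x y] Oxy|z [i [_ _ +] iz]]; last exact.
  have /nbhs_ballP[e /= e0 be] := open_nbhs_nbhs (conj oO Oxy).
  have [n ne] : exists n, (r n + r n < e)%R.
    have e2 : (0 < e / 2)%R by rewrite divr_gt0.
    have [n _ /(_ n (leqnn n))] := near_infty_natSinv_lt (PosNum e2).
    by move=> /= rn; exists n; rewrite [ltRHS]splitr ltrD.
  have [s Ss sx] := near_S x n; have [t St ty] := near_S y n.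
  exists (s, t, n) => //; split => // -[x' y'] [/= sx' ty'].
  apply: be; split => /=.
    by apply: le_ball (ltW ne) _ _; apply: ball_triangle sx'; exact: ball_sym.
  by apply: le_ball (ltW ne) _ _; apply: ball_triangle ty'; exact: ball_sym.
rewrite bigcup_set_type.
apply: countable_bigcupT_measurable.
  by rewrite (eq_countable (card_setT I)).
by move=> i; apply: measurableX; exact: metric_ball_measurable.
Qed.

Lemma lsc_measurable_prod (g : X * X -> \bar R) :
  lower_semicontinuous g -> measurable_fun [set: X * X] g.
Proof.
move=> scg; apply: (measurability _ (ErealGenOInfty.measurableE R)).
move=> /= _ [_ [a ->]] <-; apply: measurableI => //.
apply: open_measurable_prod.
by rewrite preimage_itvoy; move/lower_semicontinuousP : scg; exact.
Qed.

End polish_product.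

(** * Integration against a mixture of measures *)

Section integral_bind.
Context d0 d1 d2 (T : measurableType d0) (Y : measurableType d1)
  (Z : measurableType d2) (R : realType).
Variables (l : R.-sfker T ~> Y) (k : R.-pker Y ~> Z) (t : T)
  (nu : {measure set Z -> \bar R}).
Hypothesis nuE : forall A, measurable A -> nu A = \int[l t]_y k y A.

(** For a composition of kernels this is [integral_kcomp], whose second kernel
    may depend on both points; [kernel_snd] is [k] regarded as such a kernel.
    A hypothesis on [nu] in place of a definition lets the same lemma serve
    for the iterates of a kernel and for an invariant measure. *)
Lemma ge0_integral_bind (g : Z -> \bar R) :
  (forall z, 0 <= g z) -> measurable_fun [set: Z] g ->
  \int[nu]_z g z = \int[l t]_y \int[k y]_z g z.
Proof.
move=> g0 mg; rewrite -(integral_kcomp l (kernel.kernel_snd k) t g0 mg).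
by apply: eq_measure_integral => A mA _; rewrite nuE.
Qed.

(** Positive and negative parts reduce this to the previous lemma.  Both
    have a [l t]-integrable inner integral, and the integral under each [k y]
    is the difference of the two by definition. *)
Lemma integral_bind (g : Z -> \bar R) : nu.-integrable [set: Z] g ->
  \int[nu]_z g z = \int[l t]_y \int[k y]_z g z.
Proof.
move=> ig; have mg := measurable_int _ ig.
have int_inner (h : Z -> \bar R) : (forall z, 0 <= h z) ->
    nu.-integrable [set: Z] h ->
    (l t).-integrable [set: Y] (fun y => \int[k y]_z h z).
  move=> h0 ih; have mh := measurable_int _ ih.
  apply/integrableP; split.
    apply: measurable_fun_integral_kernel => // U mU.
    exact: measurable_kernel.
  move/integrableP : ih => [_].
  under eq_integral do rewrite gee0_abs//.
  rewrite ge0_integral_bind//.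
  by under [X in _ -> X < _]eq_integral do rewrite gee0_abs ?integral_ge0//.
rewrite [LHS]integralE !ge0_integral_bind//; last 2 first.
- exact: measurable_funeneg.
- exact: measurable_funepos.
rewrite -integralB//.
- by apply: eq_integral => y _; rewrite [RHS]integralE.
- by apply: int_inner => //; exact: integrable_funepos.
- by apply: int_inner => //; exact: integrable_funeneg.
Qed.

End integral_bind.

(** * Geometrically convergent sequences *)

Section geometric.
Context (R : realType).
Variables (kappa : R).
Hypothesis kappa01 : (0 <= kappa < 1)%R.
Local Open Scope ring_scope.

Lemma geometric_cvg0 B : (fun k => kappa ^+ k * B) @ \oo --> 0.
Proof.
have /andP[k0 k1] := kappa01.
rewrite -[X in _ --> X](mul0r B); apply: cvgM; last exact: cvg_cst.
by apply: cvg_expr; rewrite ger0_norm.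
Qed.

Lemma le_geometric_le0 (a B : R) : (forall k, a <= kappa ^+ k * B) -> a <= 0.
Proof.
move=> aB; apply: (cvgr_to_ge (F := \oo) (geometric_cvg0 B)).
by near=> k; exact: aB.
Unshelve. all: by end_near. Qed.

Lemma geometric_cauchy (s : R^nat) B :
  (forall k l, `|s (k + l)%N - s k| <= kappa ^+ k * B) ->
  exists2 a, s @ \oo --> a & forall k, `|a - s k| <= kappa ^+ k * B.
Proof.
move=> sB; have cs : cvg (s @ \oo).
  apply/cauchy_cvgP/cauchy_exP => e e0.
  have /cvgrPdist_lt/(_ e e0)[k _ /(_ k (leqnn k))/=] := geometric_cvg0 B.
  rewrite sub0r normrN => ke; exists (s k).
  near=> n; rewrite -ball_normE/= distrC.
  have kn : (k <= n)%N by near: n; exists k.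
  rewrite -(subnKC kn) (le_lt_trans (sB _ _))// (le_lt_trans _ ke)//.
  exact: ler_norm.
exists (limn s) => // k.
have sk : (fun n => `|s n - s k|) @ \oo --> `|limn s - s k|.
  by apply: cvg_norm; apply: cvgB => //; exact: cvg_cst.
apply: (cvgr_to_le (F := \oo) sk); near=> n.
have kn : (k <= n)%N by near: n; exists k.
by rewrite -(subnKC kn).
Unshelve. all: by end_near. Qed.

End geometric.

(** * Lipschitz functions and couplings *)

Section lipschitz.
Context (disp : measure_display) (R : realType) (X : polishType disp R).
Variable dist : X -> X -> R.
Hypothesis X_nontrivial : exists x y : X, x <> y.
Hypothesis dist_metric : is_metric dist.
Hypothesis dist_lsc :
  lower_semicontinuous (fun z : (X * X)%type => (dist z.1 z.2)%:E).

Let dist_ge0 x y : (0 <= dist x y)%R. Proof. by case: dist_metric. Qed.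
Let distxx x : dist x x = 0%R.
Proof. by case: dist_metric => _ /(_ x x)[_ ->]. Qed.
Let dist_sym x y : dist x y = dist y x. Proof. by case: dist_metric. Qed.
Let dist_tri y x z : (dist x z <= dist x y + dist y z)%R.
Proof. by case: dist_metric. Qed.
Let dist_gt0 x y : x <> y -> (0 < dist x y)%R.
Proof.
move=> xy; rewrite lt_neqAle dist_ge0 andbT eq_sym; apply/eqP => d0; apply: xy.
by case: dist_metric => _ /(_ x y)[+ _] _ _; exact.
Qed.

Lemma measurable_dist : measurable_fun [set: X * X] (fun z => dist z.1 z.2).
Proof. by apply/measurable_EFinP; exact: lsc_measurable_prod. Qed.

Lemma measurable_distr x : measurable_fun [set: X] (dist x).
Proof. exact: (measurableT_comp measurable_dist (measurable_pair1 x)). Qed.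

Definition lip_with (L : R) (f : X -> R) :=
  forall x y, (`|f x - f y| <= L * dist x y)%R.

Lemma lip_normP L f : lip_norm dist f <= L%:E <-> lip_with L f.
Proof.
split => [fL x y|fL].
  have [->|/eqP xy] := eqVneq x y; first by rewrite subrr normr0 distxx mulr0.
  rewrite -ler_pdivrMr ?dist_gt0// -lee_fin (le_trans _ fL)//.
  by apply: ereal_sup_ubound; exists (x, y).
apply: ge_ereal_sup => _ [[x y] /= xy <-].
by rewrite lee_fin ler_pdivrMr ?dist_gt0.
Qed.

Lemma lip_norm_ge0 f : 0 <= lip_norm dist f.
Proof.
have [x [y xy]] := X_nontrivial.
apply: (@le_trans _ _ (`|f x - f y| / dist x y)%:E).
  by rewrite lee_fin divr_ge0.
by apply: ereal_sup_ubound; exists (x, y).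
Qed.

Lemma lip_norm_attained f : lip_norm dist f < +oo ->
  exists L, [/\ (0 <= L)%R, lip_norm dist f = L%:E & lip_with L f].
Proof.
move=> foo; have f0 := lip_norm_ge0 f.
have fE : lip_norm dist f = (fine (lip_norm dist f))%:E.
  by rewrite fineK// ge0_fin_numE.
exists (fine (lip_norm dist f)); split => //; first exact: fine_ge0.
by apply/lip_normP; rewrite -fE.
Qed.

Definition mlip (f : X -> R) :=
  measurable_fun [set: X] f /\ exists2 L, (0 <= L)%R & lip_with L f.

Lemma mlip_lip_norm f : mlip f -> lip_norm dist f < +oo.
Proof.
by move=> [_ [L _ /lip_normP fL]]; rewrite (le_lt_trans fL)// ltry.
Qed.

Lemma lip_spaceP f : lip_space dist f <-> mlip f.
Proof.
split=> [[mf /lip_norm_attained[L [L0 _ fL]]]|lf]; split => //.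
- by exists L.
- by case: lf.
- exact: mlip_lip_norm.
Qed.

Lemma mlip_cst c : mlip (fun=> c).
Proof.
split; first exact: measurable_cst.
by exists 0%R => // x y; rewrite subrr normr0 mul0r.
Qed.

Lemma lip_withD L M f g : lip_with L f -> lip_with M g ->
  lip_with (L + M) (fun x => f x + g x)%R.
Proof.
move=> fL gM x y; rewrite opprD addrACA mulrDl (le_trans (ler_normD _ _))//.
by rewrite lerD.
Qed.

Lemma lip_withB L M f g : lip_with L f -> lip_with M g ->
  lip_with (L + M) (fun x => f x - g x)%R.
Proof.
move=> fL gM; apply: lip_withD => // x y.
by rewrite -opprD normrN.
Qed.

Lemma mlipD f g : mlip f -> mlip g -> mlip (fun x => f x + g x)%R.
Proof.
move=> [mf [L L0 fL]] [mg [M M0 gM]]; split; first exact: measurable_funD.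
by exists (L + M)%R; [exact: addr_ge0|exact: lip_withD].
Qed.

Lemma mlipB f g : mlip f -> mlip g -> mlip (fun x => f x - g x)%R.
Proof.
move=> [mf [L L0 fL]] [mg [M M0 gM]]; split; first exact: measurable_funB.
by exists (L + M)%R; [exact: addr_ge0|exact: lip_withB].
Qed.

Lemma mlipZ c f : mlip f -> mlip (fun x => c * f x)%R.
Proof.
move=> [mf [L L0 fL]]; split; first exact: measurable_funM.
exists (`|c| * L)%R => [|x y]; first by rewrite mulr_ge0.
by rewrite -mulrBr normrM -mulrA ler_wpM2l.
Qed.

Lemma lip_with_dist x : lip_with 1 (dist x).
Proof.
move=> y z; rewrite mul1r ler_norml; apply/andP; split.
  by rewrite lerNl opprB lerBlDr addrC; exact: dist_tri.
by rewrite lerBlDr (dist_sym y) addrC; exact: dist_tri.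
Qed.

Lemma mlip_dist x : mlip (dist x).
Proof.
split; first exact: measurable_distr.
by exists 1%R => //; exact: lip_with_dist.
Qed.

(** Independent of the point chosen, by the triangle inequality; it is the
    condition under which Lipschitz functions are integrable. *)
Definition finite_first_moment (m : {measure set X -> \bar R}) :=
  exists x, \int[m]_y (dist x y)%:E < +oo.

Lemma mlip_integrable (m : {measure set X -> \bar R}) f :
  m [set: X] = 1 -> finite_first_moment m -> mlip f ->
  m.-integrable [set: X] (EFin \o f).
Proof.
move=> m1 [x mx] [mf [L L0 fL]].
have mE g : measurable_fun [set: X] g -> measurable_fun [set: X] (EFin \o g).
  by move=> mg; exact/measurable_EFinP.
apply: (@le_integrable _ _ _ _ _ measurableT _
    (EFin \o (fun y => `|f x| + L * dist x y)%R)).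
- exact: mE.
- move=> y _ /=; rewrite lee_fin [leRHS]ger0_norm ?addr_ge0 ?mulr_ge0//.
  rewrite -lerBlDl (le_trans (lerB_dist _ _))//.
  by rewrite dist_sym.
apply: (@eq_integrable _ _ _ _ _ measurableT
   ((fun=> `|f x|%:E) \+ (fun y => L%:E * (dist x y)%:E))) => //.
apply: integrableD => //.
  apply/integrableP; split; first exact: measurable_cst.
  by rewrite integral_cst//= m1 mule1 normr_id ltry.
apply: integrableZl => //; apply/integrableP; split.
  by apply: mE; exact: measurable_distr.
by under eq_integral do rewrite gee0_abs ?lee_fin//.
Qed.

Section coupling.
Variables (m1 m2 : {measure set X -> \bar R})
  (eta : probability (X * X)%type R).
Hypothesis eta12 : coupling m1 m2 eta.

Let marginal (m : {measure set X -> \bar R}) (p : (X * X)%type -> X)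
  (g : X -> \bar R) : measurable_fun [set: X * X] p ->
  (forall A, measurable A -> eta (p @^-1` A) = m A) ->
  measurable_fun [set: X] g -> \int[m]_x g x = \int[eta]_z g (p z).
Proof.
move=> mp pE mg.
have H h : (forall x, 0 <= h x) -> measurable_fun setT h ->
    \int[m]_x h x = \int[eta]_z h (p z).
  move=> h0 mh; rewrite (eq_measure_integral (pushforward eta p)).
    by rewrite ge0_integral_pushforward.
  by move=> A mA _; rewrite -pE.
rewrite [LHS]integralE [RHS]integralE !H//.
- by congr (_ - _); apply: eq_integral => z _; rewrite ?funeposE ?funenegE.
- exact: measurable_funeneg.
- exact: measurable_funepos.
Qed.

Lemma coupling_integral1 (g : X -> \bar R) : measurable_fun [set: X] g ->
  \int[m1]_x g x = \int[eta]_z g z.1.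
Proof.
by apply: marginal => [|A mA]; [exact: measurable_fst|case: (eta12 mA)].
Qed.

Lemma coupling_integral2 (g : X -> \bar R) : measurable_fun [set: X] g ->
  \int[m2]_x g x = \int[eta]_z g z.2.
Proof.
by apply: marginal => [|A mA]; [exact: measurable_snd|case: (eta12 mA)].
Qed.

(** [d (x, z2) <= d (x, z1) + d (z1, z2)], integrated against the coupling. *)
Lemma coupling_first_moment : \int[eta]_z (dist z.1 z.2)%:E < +oo ->
  finite_first_moment m1 -> finite_first_moment m2.
Proof.
move=> etad [x mx]; exists x.
have mx_ : measurable_fun [set: X] (fun y => (dist x y)%:E).
  by apply/measurable_EFinP; exact: measurable_distr.
have m1x := measurableT_comp mx_ (@measurable_fst _ _ X X).
have m2x := measurableT_comp mx_ (@measurable_snd _ _ X X).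
have md : measurable_fun [set: X * X] (fun z => (dist z.1 z.2)%:E).
  by apply/measurable_EFinP; exact: measurable_dist.
rewrite coupling_integral2//; rewrite coupling_integral1// in mx.
apply: (@le_lt_trans _ _
    (\int[eta]_z ((dist x z.1)%:E + (dist z.1 z.2)%:E))).
  apply: ge0_le_integral => //.
  - by move=> z _; rewrite lee_fin.
  - exact: emeasurable_funD.
  - by move=> z _; rewrite -EFinD lee_fin.
rewrite ge0_integralD//; first exact: lte_add_pinfty.
- by move=> z _; rewrite lee_fin.
- by move=> z _; rewrite lee_fin.
Qed.

(** The elementary half of Kantorovich duality: the difference of the two
    integrals is the [eta]-integral of [f z.1 - f z.2]. *)
Lemma coupling_lip_bound L c f : m1 [set: X] = 1 -> m2 [set: X] = 1 ->
  finite_first_moment m1 -> finite_first_moment m2 ->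
  mlip f -> (0 <= L)%R -> lip_with L f ->
  \int[eta]_z (dist z.1 z.2)%:E <= c%:E ->
  (`|\int[m1]_x f x - \int[m2]_x f x| <= L * c)%R.
Proof.
move=> m11 m21 M1 M2 lf L0 fL etac; have [mf _] := lf.
have mEf : measurable_fun setT (EFin \o f) by exact/measurable_EFinP.
have mEa : measurable_fun setT (fun x => `|(f x)%:E|).
  exact: measurableT_comp.
have i1 : eta.-integrable setT (EFin \o (f \o fst)).
  apply/integrableP; split.
    by apply: (measurableT_comp mEf); exact: measurable_fst.
  have /integrableP[_] := mlip_integrable m11 M1 lf.
  by rewrite (coupling_integral1 mEa).
have i2 : eta.-integrable setT (EFin \o (f \o snd)).
  apply/integrableP; split.
    by apply: (measurableT_comp mEf); exact: measurable_snd.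
  have /integrableP[_] := mlip_integrable m21 M2 lf.
  by rewrite (coupling_integral2 mEa).
have id : eta.-integrable setT (EFin \o (fun z => dist z.1 z.2)).
  apply/integrableP; split.
    by apply/measurable_EFinP; exact: measurable_dist.
  under eq_integral do rewrite gee0_abs ?lee_fin//.
  by rewrite (le_lt_trans etac)// ltry.
have -> : (\int[m1]_x f x = \int[eta]_z f z.1)%R.
  by rewrite /Rintegral coupling_integral1.
have -> : (\int[m2]_x f x = \int[eta]_z f z.2)%R.
  by rewrite /Rintegral coupling_integral2.
rewrite -RintegralB//.
apply: (le_trans (le_normr_Rintegral measurableT _)).
  exact: (integrableB measurableT i1 i2).
apply: (@le_trans _ _ (\int[eta]_z (L * dist z.1 z.2))%R).
  apply: le_Rintegral => //.
    exact: (integrable_abse (integrableB measurableT i1 i2)).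
  exact: (integrableZl measurableT _ id).
rewrite RintegralZl// ler_wpM2l// -lee_fin fineK//.
exact: integrable_fin_num.
Qed.

End coupling.

(** * Action of a kernel on Lipschitz functions *)

Lemma tau_ge0 (K : R.-pker X ~> X) : 0 <= tau dist K.
Proof.
have [x [y xy]] := X_nontrivial.
apply: (@le_trans _ _ (wasserstein dist (K x) (K y) / (dist x y)%:E)).
  apply: mule_ge0; last by rewrite inve_ge0 lee_fin.
  apply: le_ereal_inf_tmp => _ [eta _ <-].
  by apply: integral_ge0 => z _; rewrite lee_fin.
by apply: ereal_sup_ubound; exists (x, y).
Qed.

Lemma tau_wasserstein (K : R.-pker X ~> X) c x y : x <> y ->
  tau dist K <= c%:E -> wasserstein dist (K x) (K y) <= (c * dist x y)%:E.
Proof.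
move=> xy Kc; rewrite EFinM -lee_pdivrMr ?dist_gt0//.
have -> : ((dist x y)^-1)%:E = (dist x y)%:E^-1.
  by rewrite inver gt_eqF ?dist_gt0.
by rewrite (le_trans _ Kc)//; apply: ereal_sup_ubound; exists (x, y).
Qed.

(** The infimum over couplings is only approached, hence the slack [e], which
    tends to [0] in [kernel_lip]. *)
Lemma tau_coupling (K : R.-pker X ~> X) c x y e : x <> y -> (0 < e)%R ->
  tau dist K <= c%:E ->
  exists2 eta : probability (X * X)%type R, coupling (K x) (K y) eta &
    \int[eta]_z (dist z.1 z.2)%:E <= (c * dist x y + e)%:E.
Proof.
move=> xy e0 /(tau_wasserstein xy) Kc.
have : wasserstein dist (K x) (K y) < (c * dist x y + e)%:E.
  by rewrite (le_lt_trans Kc)// lte_fin ltrDl.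
by move=> /ereal_inf_lt[_ [eta eta12 <-]] /ltW; exists eta.
Qed.

Lemma tau_first_moment (K : R.-pker X ~> X) : tau dist K < +oo ->
  (exists y, finite_first_moment (K y)) -> forall x, finite_first_moment (K x).
Proof.
move=> Koo [y My] x; have [<-//|/eqP yx] := eqVneq y x.
have Kc : tau dist K <= (fine (tau dist K))%:E.
  by rewrite fineK// ge0_fin_numE// tau_ge0.
have [eta eta12 etac] := tau_coupling yx ltr01 Kc.
by apply: (coupling_first_moment eta12) My; rewrite (le_lt_trans etac)// ltry.
Qed.

(** The dual form of the coefficient [tau], obtained from the bound for almost
    optimal couplings of [K x] and [K y]. *)
Lemma kernel_lip (K : R.-pker X ~> X) c L f : tau dist K <= c%:E ->
  (forall x, finite_first_moment (K x)) ->
  mlip f -> (0 <= L)%R -> lip_with L f ->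
  lip_with (c * L) (fun x => \int[K x]_y f y)%R.
Proof.
move=> Kc MK lf L0 fL x y.
have [->|/eqP xy] := eqVneq x y; first by rewrite subrr normr0 distxx mulr0.
have H e : (0 < e)%R ->
    (`|\int[K x]_z f z - \int[K y]_z f z| <= L * (c * dist x y + e))%R.
  move=> e0; have [eta eta12 etac] := tau_coupling xy e0 Kc.
  by apply: (coupling_lip_bound eta12) => //; exact: prob_kernel.
(* Slack [e / (L + 1)] rather than [e / L], as [L] may vanish. *)
rewrite mulrAC mulrC; apply/ler_addgt0Pr => e e0.
have L1 : (0 < L + 1)%R by rewrite ltr_wpDl.
apply: (le_trans (H (e / (L + 1)) _)%R); first by rewrite divr_gt0.
rewrite mulrDr lerD2l mulrA ler_pdivrMr// mulrC.
by rewrite ler_wpM2l ?ltW// ltrDl.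
Qed.

Lemma measurable_Rintegral_kernel (K : R.-pker X ~> X) f :
  measurable_fun [set: X] f ->
  measurable_fun [set: X] (fun x => \int[K x]_y f y)%R.
Proof.
move=> mf; have mEf : measurable_fun setT (EFin \o f) by exact/measurable_EFinP.
apply: (measurableT_comp (fine_measurable measurableT)) => //.
under eq_fun do rewrite integralE.
apply: emeasurable_funB; apply: measurable_fun_integral_kernel => //.
- by move=> U mU; exact: measurable_kernel.
- exact: measurable_funepos.
- by move=> U mU; exact: measurable_kernel.
- exact: measurable_funeneg.
Qed.

Lemma kernel_mlip (K : R.-pker X ~> X) f : tau dist K < +oo ->
  (forall x, finite_first_moment (K x)) -> mlip f ->
  mlip (fun x => \int[K x]_y f y)%R.
Proof.
move=> Koo MK lf; have [mf [L L0 fL]] := lf.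
split; first exact: measurable_Rintegral_kernel.
exists (fine (tau dist K) * L)%R.
  by rewrite mulr_ge0// fine_ge0// tau_ge0.
by apply: kernel_lip => //; rewrite fineK// ge0_fin_numE// tau_ge0.
Qed.

(** * Centred Lipschitz functions *)

Variable mu : probability X R.

Let measurable_powR_EFin (g : X -> R) r : measurable_fun [set: X] g ->
  measurable_fun [set: X] (fun x => (g x `^ r)%R%:E).
Proof.
move=> mg; apply/measurable_EFinP.
exact: (measurableT_comp (measurable_powR r) mg).
Qed.

(** From [t <= 1 + t ^ p], valid for [t >= 0] and [p >= 1]. *)
Lemma eccentricity_first_moment p : (1 <= p)%R ->
  (exists x, eccentricity dist mu p x < +oo) -> finite_first_moment mu.
Proof.
move=> p1 [x Epx]; exists x.
have md := measurable_distr x.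
apply: (@le_lt_trans _ _ (\int[mu]_y (1 + (dist x y `^ p)%R%:E))).
  apply: ge0_le_integral => //.
  - by move=> y _; rewrite lee_fin.
  - exact/measurable_EFinP.
  - by apply: emeasurable_funD => //; exact: measurable_powR_EFin.
  - move=> y _; rewrite -EFinD lee_fin; have [d1|/ltW d1] := leP (dist x y) 1%R.
      by rewrite (le_trans d1)// lerDl powR_ge0.
    by rewrite (le_trans (le1r_powR d1 p1))// lerDr.
rewrite ge0_integralD//.
- rewrite integral_cst// mul1e lte_add_pinfty//.
  exact: (le_lt_trans (probability_le1 mu measurableT) (ltry _)).
- by move=> y _; rewrite lee_fin powR_ge0.
- exact: measurable_powR_EFin.
Qed.

Hypothesis mu_moment : finite_first_moment mu.

Let mu_integrable f : mlip f -> mu.-integrable setT (EFin \o f).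
Proof. by apply: mlip_integrable => //; exact: probability_setT. Qed.

Let muT : fine (mu [set: X]) = 1%R. Proof. by rewrite probability_setT. Qed.

Definition centered f := mlip f /\ (\int[mu]_x f x)%R = 0%R.

Lemma lip_space0P f : lip_space0 dist mu f <-> centered f.
Proof.
have fin g : mlip g -> \int[mu]_x (g x)%:E \is a fin_num.
  by move=> lg; apply: integrable_fin_num => //; exact: mu_integrable.
split=> [[/lip_spaceP lf f0]|[lf f0]].
  by split => //; rewrite /Rintegral f0.
split; first exact/lip_spaceP.
by rewrite -(fineK (fin _ lf)) [fine _]f0.
Qed.

Local Open Scope ring_scope.

Lemma centered0 : centered (fun=> 0).
Proof. by split; [exact: mlip_cst|rewrite Rintegral_cst// mul0r]. Qed.

Lemma centeredB f g : centered f -> centered g ->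
  centered (fun x => f x - g x).
Proof.
move=> [lf f0] [lg g0]; split; first exact: mlipB.
by rewrite RintegralB ?mu_integrable// f0 g0 subrr.
Qed.

Lemma centeredD f g : centered f -> centered g ->
  centered (fun x => f x + g x).
Proof.
move=> [lf f0] [lg g0]; split; first exact: mlipD.
by rewrite RintegralD ?mu_integrable// f0 g0 addr0.
Qed.

(** The eccentricity of exponent [1], as a real number. *)
Definition mean_dist x := \int[mu]_y dist x y.

Lemma mean_dist_ge0 x : 0 <= mean_dist x.
Proof. by apply: Rintegral_ge0 => y _. Qed.

Lemma eccentricity1E x : (eccentricity dist mu 1 x = (mean_dist x)%:E)%E.
Proof.
rewrite /eccentricity /mean_dist /Rintegral fineK.
  by apply: eq_integral => y _; rewrite powRr1.
by apply: integrable_fin_num => //; exact/mu_integrable/mlip_dist.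
Qed.

(** A function of mean zero has [f x] equal to the mean of [f x - f y] over
    [y]. *)
Lemma centered_bound f L x : centered f -> lip_with L f ->
  `|f x| <= L * mean_dist x.
Proof.
move=> [lf f0] fL.
have -> : f x = \int[mu]_y (f x - f y).
  rewrite RintegralB ?mu_integrable//; last exact: mlip_cst.
  by rewrite Rintegral_cst// muT mulr1 f0 subr0.
have lc : mlip (fun y => f x - f y) by apply: mlipB => //; exact: mlip_cst.
apply: (le_trans (le_normr_Rintegral measurableT (mu_integrable lc))).
rewrite -RintegralZl ?mu_integrable//; last exact: mlip_dist.
apply: le_Rintegral => //.
  exact: (integrable_abse (mu_integrable lc)).
by apply/mu_integrable/mlipZ/mlip_dist.
Qed.

Lemma mean_dist_mlip : mlip mean_dist.
Proof.
split.
  apply: (measurableT_comp (fine_measurable measurableT)) => //.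
  apply: (measurable_fun_fubini_tonelli_F (fun z => (dist z.1 z.2)%:E)).
    by apply/measurable_EFinP; exact: measurable_dist.
  by move=> z; rewrite lee_fin.
exists 1 => // x y.
have ld z : mlip (dist z) by exact: mlip_dist.
rewrite -RintegralB ?mu_integrable//.
apply: (le_trans (le_normr_Rintegral measurableT _)).
  exact: (mu_integrable (mlipB (ld x) (ld y))).
have -> : 1 * dist x y = \int[mu]_z dist x y.
  by rewrite Rintegral_cst// muT mulr1 mul1r.
apply: le_Rintegral => //.
- exact: (integrable_abse (mu_integrable (mlipB (ld x) (ld y)))).
- by apply: mu_integrable; exact: mlip_cst.
- move=> z _; rewrite (dist_sym x z) (dist_sym y z).
  by rewrite -[leRHS]mul1r; exact: lip_with_dist.
Qed.

(** * Fixed points of contractions of centred functions *)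

Section contraction.
Variables (F : (X -> R) -> X -> R) (kappa : R) (E' : X -> R).
Hypothesis kappa01 : 0 <= kappa < 1.
Hypothesis F_centered : forall h, centered h -> centered (F h).
Hypothesis F_lip : forall h h' L, centered h -> centered h' -> 0 <= L ->
  lip_with L (fun x => h x - h' x) ->
  lip_with (kappa * L) (fun x => F h x - F h' x).
(* Pointwise continuity, which lets [F] pass to the limit of its iterates;
   for an affine map with positive linear part [Q], [E'] is the image
   [Q mean_dist] of the weight. *)
Hypothesis F_dominated : forall h h' c, centered h -> centered h' ->
  (forall x, `|h x - h' x| <= c * mean_dist x) ->
  forall x, `|F h x - F h' x| <= c * E' x.

Let kappa0 : 0 <= kappa. Proof. by case/andP: kappa01. Qed.

(** The iterates of [F] do not move [u] and [v], so [kappa ^ k * L] is a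
    Lipschitz constant of [u - v] for all [k]. *)
Lemma contraction_fixed_unique u v : centered u -> centered v ->
  F u = u -> F v = v -> u = v.
Proof.
move=> cu cv Fu Fv; have cuv := centeredB cu cv.
have [[_ [L L0 uvL]] _] := cuv.
have uvLk k : lip_with (kappa ^+ k * L) (fun x => u x - v x).
  elim: k => [|k IH]; first by rewrite mul1r.
  rewrite exprS -mulrA -{1}Fu -{1}Fv; apply: F_lip => //.
  by rewrite mulr_ge0 ?exprn_ge0.
apply/funext => x; apply/eqP; rewrite -subr_eq0 -normr_le0.
apply: (le_geometric_le0 kappa01 (B := L * mean_dist x)) => k.
by rewrite mulrA; exact: (centered_bound x cuv).
Qed.

(** Banach iteration from [0].  The iterates are uniformly Lipschitz and
    pointwise Cauchy, at the rate [kappa ^ k] with weight [mean_dist]; the limit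
    is centred because this weight is [mu]-integrable. *)
Lemma contraction_fixed_exists : exists2 u, centered u & F u = u.
Proof.
have [[_ [L L0 FL]] _] := F_centered centered0.
have /andP[_ kappa1] := kappa01.
(* Common Lipschitz constant of all iterates, solving [kappa * M + L = M]. *)
pose M := L / (1 - kappa).
have M0 : 0 <= M by rewrite divr_ge0// subr_ge0 ltW.
have LM : kappa * M + L = M.
  by rewrite /M; field; rewrite subr_eq0 eq_sym lt_eqF.
pose S k := iter k F (fun=> 0).
have cS k : centered (S k).
  elim: k => [|k IH]; first exact: centered0.
  exact: F_centered.
have lS k : mlip (S k) by case: (cS k).
have S_lip k : lip_with M (S k).
  elim: k => [x y|k IH]; first by rewrite subrr normr0 mulr_ge0.
  have -> : S k.+1 = (fun x => F (S k) x - F (fun=> 0) x + F (fun=> 0) x).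
    by apply/funext => x; rewrite subrK.
  rewrite -[X in lip_with X]LM; apply: lip_withD => //; apply: F_lip => //.
    exact: centered0.
  by move=> x y; rewrite !subr0; exact: IH.
have S_diff k l : lip_with (kappa ^+ k * M) (fun x => S (k + l)%N x - S k x).
  elim: k => [x y|k IH].
    by rewrite expr0 mul1r !subr0 add0n; exact: S_lip.
  by rewrite exprS -mulrA; apply: F_lip => //; rewrite mulr_ge0 ?exprn_ge0.
have S_cauchy x k l :
    `|S (k + l)%N x - S k x| <= kappa ^+ k * (M * mean_dist x).
  by rewrite mulrA; exact: (centered_bound x (centeredB (cS _) (cS _))).
have {S_cauchy} /choice[u uP] : forall x, exists a,
    (fun k => S k x) @ \oo --> a /\
    forall k, `|a - S k x| <= kappa ^+ k * (M * mean_dist x).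
  by move=> x; have [a ? ?] := geometric_cauchy kappa01 (S_cauchy x); exists a.
have lu : mlip u.
  split.
    apply: (@measurable_fun_cvg _ _ _ _ S) => [k|x _]; last by case: (uP x).
    by case: (lS k).
  exists M => // x y.
  have [Sx _] := uP x; have [Sy _] := uP y.
  have Sxy : (fun k => `|S k x - S k y|) @ \oo --> `|u x - u y|.
    by apply: cvg_norm; exact: cvgB.
  by apply: (cvgr_to_le (F := \oo) Sxy); near=> k; exact: S_lip.
have uS k x : `|u x - S k x| <= kappa ^+ k * M * mean_dist x.
  by rewrite -mulrA; case: (uP x).
have cu : centered u.
  split => //; apply/eqP; rewrite -normr_le0.
  apply: (le_geometric_le0 kappa01 (B := M * \int[mu]_x mean_dist x)) => k.
  have [_ Sk0] := cS k; have iuS := mu_integrable (mlipB lu (lS k)).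
  rewrite -(subr0 (\int[mu]_x u x)) -Sk0 -RintegralB ?mu_integrable//.
  apply: (le_trans (le_normr_Rintegral measurableT iuS)).
  have lE := mean_dist_mlip.
  rewrite mulrA -RintegralZl ?mu_integrable//.
  apply: le_Rintegral => //; first exact: (integrable_abse iuS).
  by apply: mu_integrable; exact: mlipZ.
exists u => //; apply/funext => x; apply/eqP; rewrite -subr_eq0 -normr_le0.
apply: (le_geometric_le0 kappa01 (B := M * (E' x + mean_dist x))) => k.
have -> : F u x - u x = (F u x - F (S k) x) - (u x - S k.+1 x).
  by rewrite /S iterS; ring.
rewrite mulrA mulrDr (le_trans (ler_normB _ _))// lerD//.
  by apply: F_dominated.
apply: (le_trans (uS k.+1 x)); rewrite ler_wpM2r//.
  exact: mean_dist_ge0.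
by rewrite ler_wpM2r// exprS ler_piMl ?exprn_ge0// ltW.
Unshelve. all: by end_near. Qed.

End contraction.

Local Close Scope ring_scope.

(** * The transition operator and Poisson's equation *)

Section transition.
Variable P : R.-pker X ~> X.
Hypothesis P_contractive : wasserstein_contractive dist P.
Hypothesis mu_inv : Defs.invariant P mu.

Let tauP : tau dist P < +oo. Proof. by case: P_contractive. Qed.

(* The constant kernel [mu], which makes invariance an instance of
   [integral_bind]. *)
Let mu_kernel : R.-sfker unit ~> X :=
  kprobability (measurable_cst (mu : pprobability X R)).

Let mu_bind A : measurable A -> mu A = \int[mu_kernel tt]_y P y A.
Proof. by move=> mA; rewrite mu_inv. Qed.

(** The [mu]-mean of the first moments of [P y] is that of [mu], so they are
    finite for at least one [y]; [tau_first_moment] extends this to all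
    points. *)
Lemma kernel_first_moment x : finite_first_moment (P x).
Proof.
apply: (tau_first_moment tauP); have [x0] := mu_moment.
have md : measurable_fun [set: X] (fun y => (dist x0 y)%:E).
  by apply/measurable_EFinP; exact: measurable_distr.
rewrite (ge0_integral_bind mu_bind)//; last first.
  by move=> z; rewrite lee_fin.
apply: contraPP => /forallNP noM.
have Py y : \int[P y]_z (dist x0 z)%:E = +oo.
  apply/eqP; rewrite -leye_eq leNgt; apply/negP => Pyx0.
  by apply: (noM y); exists x0.
under eq_integral do rewrite Py.
rewrite integral_cst//= probability_setT.
by rewrite mulyr gtr0_sg// mul1e ltxx.
Qed.

Definition trans_op (f : X -> R) : X -> R := fun x => (\int[P x]_y f y)%R.

Lemma trans_op_mlip f : mlip f -> mlip (trans_op f).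
Proof. by apply: kernel_mlip => //; exact: kernel_first_moment. Qed.

Let P_integrable f x : mlip f -> (P x).-integrable setT (EFin \o f).
Proof.
apply: mlip_integrable => //; first exact: prob_kernel.
exact: kernel_first_moment.
Qed.

Lemma trans_opE f x : mlip f -> kapply P f x = (trans_op f x)%:E.
Proof.
move=> lf; rewrite /kapply /trans_op /Rintegral fineK//.
by rewrite integrable_fin_num// P_integrable.
Qed.

Lemma trans_opB f g : mlip f -> mlip g ->
  trans_op (fun x => f x - g x)%R = (fun x => trans_op f x - trans_op g x)%R.
Proof.
by move=> lf lg; apply/funext => x; rewrite /trans_op RintegralB ?P_integrable.
Qed.

Lemma trans_opZ c f : mlip f ->
  trans_op (fun x => c * f x)%R = (fun x => c * trans_op f x)%R.
Proof.
by move=> lf; apply/funext => x; rewrite /trans_op RintegralZl ?P_integrable.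
Qed.

Lemma trans_op_dominated h g : mlip h -> mlip g ->
  (forall x, `|h x| <= g x)%R -> (forall x, `|trans_op h x| <= trans_op g x)%R.
Proof.
move=> lh lg hg x; have ih := P_integrable x lh.
apply: (le_trans (le_normr_Rintegral measurableT ih)).
apply: le_Rintegral => //; [exact: (integrable_abse ih)|exact: P_integrable].
Qed.

Lemma trans_op_mean f : mlip f -> (\int[mu]_x trans_op f x = \int[mu]_x f x)%R.
Proof.
move=> lf; congr fine.
rewrite [RHS](integral_bind mu_bind); last exact: mu_integrable.
by apply: eq_integral => x _; rewrite -trans_opE.
Qed.

Lemma iter_trans_op_mlip n f : mlip f -> mlip (iter n trans_op f).
Proof. by move=> lf; elim: n => // n; exact: trans_op_mlip. Qed.

Let kiter_bind n x A : measurable A ->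
  kiter P n.+1 x A = \int[P x]_y kiter P n y A.
Proof. by []. Qed.

(** Precedes the version for all Lipschitz functions, as finiteness of the
    first moments of the iterates comes from the case [f = dist x]. *)
Lemma kiter_ge0_integral n f x : mlip f -> (forall y, 0 <= f y)%R ->
  \int[kiter P n x]_y (f y)%:E = (iter n trans_op f x)%:E.
Proof.
move=> lf f0; have mf : measurable_fun [set: X] (EFin \o f).
  by apply/measurable_EFinP; case: lf.
elim: n x => [x|n IH x]; first by rewrite /= integral_dirac// diracT mul1e.
rewrite (ge0_integral_bind (kiter_bind n x))//.
rewrite iterS -trans_opE; last exact: iter_trans_op_mlip.
by apply: eq_integral => y _; rewrite IH.
Qed.

Lemma kiter_first_moment n x : finite_first_moment (kiter P n x).
Proof.
exists x; rewrite kiter_ge0_integral ?ltry//.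
exact: mlip_dist.
Qed.

Lemma kiter_integral n f x : mlip f ->
  (\int[kiter P n x]_y f y = iter n trans_op f x)%R.
Proof.
move=> lf; suff H : \int[kiter P n x]_y (f y)%:E = (iter n trans_op f x)%:E.
  by rewrite /Rintegral H.
elim: n x => [x|n IH x].
  rewrite /= integral_dirac// ?diracT ?mul1e//.
  by apply/measurable_EFinP; case: lf.
rewrite (integral_bind (kiter_bind n x)); last first.
  apply: mlip_integrable => //.
    exact: (@prob_kernel _ _ _ _ _ (kiter P n.+1)).
  exact: (kiter_first_moment n.+1).
rewrite iterS -trans_opE; last exact: iter_trans_op_mlip.
by apply: eq_integral => y _; rewrite IH.
Qed.

Lemma iter_trans_op_lip n c L f : tau dist (kiter P n) <= c%:E ->
  mlip f -> (0 <= L)%R -> lip_with L f -> lip_with (c * L) (iter n trans_op f).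
Proof.
move=> Kc lf L0 fL x y; rewrite -!kiter_integral//.
by apply: (kernel_lip Kc) => //; exact: kiter_first_moment.
Qed.

Lemma iter_trans_opB n f g : mlip f -> mlip g ->
  iter n trans_op (fun x => f x - g x)%R =
  (fun x => iter n trans_op f x - iter n trans_op g x)%R.
Proof.
move=> lf lg; elim: n => // n IH.
by rewrite !iterS IH trans_opB//; exact: iter_trans_op_mlip.
Qed.

Lemma iter_trans_opZ n c f : mlip f ->
  iter n trans_op (fun x => c * f x)%R = (fun x => c * iter n trans_op f x)%R.
Proof.
move=> lf; elim: n => // n IH; rewrite !iterS IH trans_opZ//.
exact: iter_trans_op_mlip.
Qed.

Lemma iter_trans_op_dominated n h g : mlip h -> mlip g ->
  (forall x, `|h x| <= g x)%R ->
  (forall x, `|iter n trans_op h x| <= iter n trans_op g x)%R.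
Proof.
move=> lh lg hg; elim: n => // n IH x; rewrite !iterS.
by apply: trans_op_dominated => //; exact: iter_trans_op_mlip.
Qed.

Section forcing.
Variable f : X -> R.
Hypothesis cf : centered f.
Local Open Scope ring_scope.

Definition poisson_map (u : X -> R) : X -> R := fun x => f x + trans_op u x.

Let poisson_map_centered u : centered u -> centered (poisson_map u).
Proof.
move=> [lu u0]; apply: centeredD => //; split; first exact: trans_op_mlip.
by rewrite trans_op_mean.
Qed.

Let iter_poisson_map_centered n u :
  centered u -> centered (iter n poisson_map u).
Proof. by move=> cu; elim: n => // n; exact: poisson_map_centered. Qed.

(** The iterates are affine, with linear part [iter n trans_op]. *)
Lemma iter_poisson_mapB n u v : centered u -> centered v ->
  (fun x => iter n poisson_map u x - iter n poisson_map v x) =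
  iter n trans_op (fun x => u x - v x).
Proof.
move=> cu cv; elim: n => // n IH; rewrite !iterS -IH trans_opB.
- by apply/funext => x; rewrite /poisson_map opprD addrACA subrr add0r.
- by case: (iter_poisson_map_centered n cu).
- by case: (iter_poisson_map_centered n cv).
Qed.

Let fixed_iter n u : poisson_map u = u -> iter n poisson_map u = u.
Proof. by move=> fu; elim: n => // n IH; rewrite iterS IH. Qed.

Lemma contractive_power : exists (m : nat) (kappa : R), [/\ 0 <= kappa < 1 &
  forall (L : R) h, mlip h -> 0 <= L -> lip_with L h ->
    lip_with (kappa * L) (iter m trans_op h)].
Proof.
case: P_contractive => _ [m [_ tau1]].
have tau0 := tau_ge0 (kiter P m).
have tauE : tau dist (kiter P m) = (fine (tau dist (kiter P m)))%:E.
  by rewrite fineK// ge0_fin_numE// (lt_trans tau1)// ltry.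
exists m, (fine (tau dist (kiter P m))); split.
  by rewrite fine_ge0//= -lte_fin -tauE.
move=> L h lh L0 hL.
apply: iter_trans_op_lip => //.
by rewrite -tauE.
Qed.

Let iter_contraction m (kappa : R) :
  (forall (L : R) h, mlip h -> 0 <= L -> lip_with L h ->
    lip_with (kappa * L) (iter m trans_op h)) ->
  forall h h' (L : R), centered h -> centered h' -> 0 <= L ->
  lip_with L (fun x => h x - h' x) ->
  lip_with (kappa * L)
    (fun x => iter m poisson_map h x - iter m poisson_map h' x).
Proof.
move=> QL h h' L ch ch' L0 hL; rewrite iter_poisson_mapB//; apply: QL => //.
by apply: mlipB; [case: ch|case: ch'].
Qed.

Lemma poisson_unique u v : centered u -> centered v ->
  poisson_map u = u -> poisson_map v = v -> u = v.
Proof.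
move=> cu cv fu fv; have [m [kappa [kappa01 QL]]] := contractive_power.
by apply: (contraction_fixed_unique kappa01 (iter_contraction QL)) => //;
  exact: fixed_iter.
Qed.

Lemma poisson_exists : exists2 u, centered u & poisson_map u = u.
Proof.
have [m [kappa [kappa01 QL]]] := contractive_power.
have [|u cu fu] := contraction_fixed_exists (E' := iter m trans_op mean_dist)
    kappa01 (iter_poisson_map_centered m) (iter_contraction QL).
  move=> h h' c ch ch' hc x.
  have lhh' : mlip (fun x => h x - h' x) by apply: mlipB; [case: ch|case: ch'].
  have := iter_trans_op_dominated m lhh' (mlipZ c mean_dist_mlip) hc x.
  rewrite iter_trans_opZ; last exact: mean_dist_mlip.
  by rewrite -iter_poisson_mapB.
(* The image of [u] is again fixed by the iterate, hence equal to [u]. *)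
exists u => //; apply: (contraction_fixed_unique kappa01 (iter_contraction QL));
  rewrite ?fu//; first exact: poisson_map_centered.
by rewrite -iterSr iterS fu.
Qed.

(** [u] is the sum of [iter n trans_op f] over [n < N] plus the remainder
    [iter N trans_op u], for every solution [u]. *)
Lemma poisson_lip u (L lambda : R) (t : nat -> R) : centered u ->
  poisson_map u = u -> 0 <= L -> lip_with L f ->
  (forall n, tau dist (kiter P n) <= (t n)%:E)%E ->
  (forall N, \sum_(0 <= n < N) t n <= lambda) ->
  lip_with (lambda * L) u.
Proof.
move=> [lu _] fu L0 fL tauPt t_sum; have [lf _] := cf.
have partial N : lip_with ((\sum_(0 <= n < N) t n) * L)
    (fun x => u x - iter N trans_op u x).
  elim: N => [x y|N IH]; first by rewrite big_nil !subrr normr0 !mul0r.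
  have -> : (fun x => u x - iter N.+1 trans_op u x) =
      (fun x => (u x - iter N trans_op u x) + iter N trans_op f x).
    have -> : f = (fun x => u x - trans_op u x).
      by apply/funext => x; rewrite -[in u x]fu /poisson_map addrK.
    rewrite iter_trans_opB//; last exact: trans_op_mlip.
    by apply/funext => x; rewrite -iterSr; ring.
  rewrite big_nat_recr//= mulrDl; apply: lip_withD => //.
  exact: iter_trans_op_lip.
have [m [kappa [kappa01 QL]]] := contractive_power.
have [_ [M M0 uM]] := lu.
have remainder k : lip_with (kappa ^+ k * M) (iter (k * m) trans_op u).
  elim: k => [|k IH]; first by rewrite mul1r.
  have /andP[kappa0 _] := kappa01.
  rewrite mulSn iterD exprS -mulrA; apply: QL => //.
    exact: iter_trans_op_mlip.
  by rewrite mulr_ge0 ?exprn_ge0.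
move=> x y; rewrite -subr_le0.
apply: (le_geometric_le0 kappa01 (B := M * dist x y)) => k.
set v := iter (k * m) trans_op u.
have -> : u x - u y = (u x - v x - (u y - v y)) + (v x - v y) by ring.
rewrite lerBlDl (le_trans (ler_normD _ _))// lerD//; last first.
  by rewrite mulrA; exact: remainder.
apply: (le_trans (partial _ x y)).
by rewrite ler_wpM2r// ler_wpM2r.
Qed.

Lemma poisson_solutionP u : centered u ->
  poisson_solution P mu f u <-> poisson_map u = u.
Proof.
move=> [lu _]; have [_ f0] := (lip_space0P f).2 cf.
split=> [sol|sol x].
  apply/funext => x; have := sol x; rewrite f0 sube0 trans_opE//.
  by rewrite /poisson_map => -[] <-; rewrite subrK.
rewrite f0 sube0 trans_opE//.
by rewrite -[in u x]sol /poisson_map -EFinB addrK.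
Qed.

Lemma poisson_lip_norm u : centered u -> poisson_map u = u ->
  (lip_norm dist u <= Lambda dist P * lip_norm dist f)%E.
Proof.
move=> cu fu; have tau0 := tau_ge0.
have [lf _] := cf.
have [L [L0 fN fL]] := lip_norm_attained (mlip_lip_norm lf).
have Lambda0 : (0 <= Lambda dist P)%E by exact: nneseries_ge0.
have [Lambda_fin|] := ltP (Lambda dist P) +oo%E; last first.
  (* An infinite [Lambda] gives a trivial bound, except against a constant
     forcing function; that one is [0], and so is its solution. *)
  rewrite leye_eq => /eqP ->; rewrite fN; have [f0|f0] := eqVneq L 0.
    rewrite f0 mule0.
    have f_eq0 x : f x = 0.
      apply/eqP; rewrite -normr_le0.
      by have := centered_bound x cf fL; rewrite f0 mul0r.
    have -> : u = (fun=> 0).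
      apply: poisson_unique => //; first exact: centered0.
      apply/funext => x.
      by rewrite /poisson_map f_eq0 add0r /trans_op Rintegral_cst// mul0r.
    apply/lip_normP => x y.
    by rewrite subrr normr0 mul0r.
  by rewrite gt0_mulye ?leey// lte_fin lt_def f0.
have LambdaE : Lambda dist P = (fine (Lambda dist P))%:E.
  by rewrite fineK// ge0_fin_numE.
have sum_le N : (\sum_(0 <= n < N) tau dist (kiter P n) <= Lambda dist P)%E.
  by apply: nneseries_lim_ge.
have tauE n : tau dist (kiter P n) = (fine (tau dist (kiter P n)))%:E.
  rewrite fineK// ge0_fin_numE//; apply: le_lt_trans Lambda_fin.
  apply: le_trans (sum_le n.+1); rewrite big_nat_recr//= leeDr//.
  by apply: sume_ge0.
rewrite LambdaE fN -EFinM; apply/lip_normP.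
apply: (poisson_lip (t := fun n => fine (tau dist (kiter P n)))) => //.
- by move=> n; rewrite -tauE.
- move=> N; rewrite -lee_fin -LambdaE -sumEFin.
  by under eq_bigr do rewrite -tauE.
Qed.

End forcing.

End transition.

(** * Moments *)

(** [a + b] is at most twice the larger of [a] and [b]. *)
Lemma powR_add_le (a b p : R) : (0 <= a)%R -> (0 <= b)%R -> (0 <= p)%R ->
  ((a + b) `^ p <= 2 `^ p * (a `^ p + b `^ p))%R.
Proof.
move=> a0 b0 p0.
have le_max (c d : R) : (0 <= c)%R -> (c <= d)%R ->
    ((c + d) `^ p <= 2 `^ p * d `^ p)%R.
  move=> c0 cd; have d0 := le_trans c0 cd.
  rewrite -powRM//; apply: ge0_ler_powR => //.
  - by rewrite nnegrE addr_ge0.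
  - by rewrite nnegrE mulr_ge0.
  - by rewrite mulr_natl mulr2n lerD2r.
have [ab|/ltW ba] := leP a b.
  rewrite (le_trans (le_max _ _ a0 ab))// ler_wpM2l ?powR_ge0//.
  by rewrite lerDr powR_ge0.
rewrite addrC (le_trans (le_max _ _ b0 ba))// ler_wpM2l ?powR_ge0//.
by rewrite lerDl powR_ge0.
Qed.

Lemma lip_moment_le u U p y : (0 <= p)%R -> measurable_fun [set: X] u ->
  (0 <= U)%R -> lip_with U u ->
  \int[mu]_x (`|u x| `^ p)%R%:E <= (2 `^ p)%R%:E *
    ((`|u y| `^ p)%R%:E + (U `^ p)%R%:E * eccentricity dist mu p y).
Proof.
move=> p0 mu_ U0 uU.
have md := measurable_powR_EFin p (measurable_distr y).
have dp0 x : 0 <= (dist y x `^ p)%R%:E by rewrite lee_fin powR_ge0.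
have -> : (2 `^ p)%R%:E *
    ((`|u y| `^ p)%R%:E + (U `^ p)%R%:E * eccentricity dist mu p y) =
  \int[mu]_x ((2 `^ p)%R%:E *
    ((`|u y| `^ p)%R%:E + (U `^ p)%R%:E * (dist y x `^ p)%R%:E)).
  rewrite ge0_integralZl_EFin ?powR_ge0//; last 2 first.
  - by move=> x _; rewrite adde_ge0 ?mule_ge0 ?lee_fin ?powR_ge0.
  - by apply: emeasurable_funD => //; exact: measurable_funeM.
  congr (_ * _); rewrite ge0_integralD//.
  - by rewrite integral_cst//= probability_setT mule1 ge0_integralZl_EFin
      ?powR_ge0.
  - by move=> x _; rewrite mule_ge0 ?lee_fin ?powR_ge0.
  - exact: measurable_funeM.
apply: ge0_le_integral => //.
- by apply: measurable_powR_EFin; exact: measurableT_comp.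
- apply: measurable_funeM; apply: emeasurable_funD => //.
  exact: measurable_funeM.
- move=> x _; rewrite -!(EFinM, EFinD) lee_fin -powRM//.
  apply: le_trans (powR_add_le _ _ p0) => //; last by rewrite mulr_ge0.
  apply: ge0_ler_powR => //; rewrite ?nnegrE ?addr_ge0 ?mulr_ge0//.
  by rewrite -lerBlDl dist_sym (le_trans (lerB_dist _ _)).
Qed.

Lemma centered_moment_le u U p : (0 <= p)%R -> centered u ->
  (0 <= U)%R -> lip_with U u ->
  \int[mu]_x (`|u x| `^ p)%R%:E <=
  (U `^ p)%R%:E * \int[mu]_x (`|eccentricity dist mu 1 x| `^ p).
Proof.
move=> p0 cu U0 uU.
have E0 := mean_dist_ge0.
have [mE _] := mean_dist_mlip.
under [X in _ <= _ * X]eq_integral.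
  by move=> x _; rewrite eccentricity1E gee0_abs ?lee_fin// poweR_EFin; over.
have mEp := measurable_powR_EFin p mE.
rewrite -ge0_integralZl_EFin ?powR_ge0//; last first.
  by move=> x _; rewrite lee_fin powR_ge0.
apply: ge0_le_integral => //.
- apply: measurable_powR_EFin; apply: measurableT_comp => //.
  by case: cu => -[].
- exact: measurable_funeM.
- move=> x _; rewrite -EFinM lee_fin -powRM//.
  apply: ge0_ler_powR; rewrite ?nnegrE ?mulr_ge0//.
  exact: (centered_bound x cu uU).
Qed.

End lipschitz.

Theorem theorem3p5 (disp : measure_display) (R : realType)
    (X : polishType disp R) (hX : exists x y : X, x <> y)
    (dist : X -> X -> R) (dist_metric : is_metric dist)
    (dist_lsc :
       lower_semicontinuous (fun z : (X * X)%type => (dist z.1 z.2)%:E))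
    (P : R.-pker X ~> X) (mu : probability X R) (p p0 : R)
    (hp : (1 <= p)%R)
    (hEp : exists x0 : X, eccentricity dist mu p x0 < +oo)
    (hP : wasserstein_contractive dist P)
    (hmu : unique_invariant P mu)
    (hp0 : (1 <= p0)%R)
    (hE1 : \int[mu]_x (`|eccentricity dist mu 1 x| `^ p0) < +oo)
    (f : X -> R) (hf : lip_space0 dist mu f) :
  (exists! u : X -> R, lip_space0 dist mu u /\ poisson_solution P mu f u) /\
  (forall u : X -> R, lip_space0 dist mu u -> poisson_solution P mu f u ->
    [/\ lip_norm dist u <= Lambda dist P * lip_norm dist f,
        \int[mu]_x (`|u x| `^ p)%R%:E <=
          (2 `^ p)%R%:E *
          ereal_inf [set (`|u y| `^ p)%R%:E
                         + lip_norm dist u `^ p * eccentricity dist mu p y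
                    | y in [set: X]] < +oo &
        \int[mu]_x (`|u x| `^ p0)%R%:E <=
          (Lambda dist P * lip_norm dist f) `^ p0
          * \int[mu]_x (`|eccentricity dist mu 1 x| `^ p0)]).
Proof.
have mu_moment := eccentricity_first_moment dist_metric dist_lsc hp hEp.
have [mu_inv _] := hmu.
have cP u := lip_space0P hX dist_metric dist_lsc mu_moment u.
have cf : centered dist mu f by exact/cP.
have solP u cu :=
  @poisson_solutionP _ _ _ _ hX dist_metric dist_lsc _ mu_moment _ hP mu_inv
    _ cf u cu.
split.
  have [u cu fu] :=
    poisson_exists hX dist_metric dist_lsc mu_moment hP mu_inv cf.
  exists u; split; first by split; [exact/cP|exact/solP].
  move=> v [/cP cv /(solP _ cv) fv].
  exact: (poisson_unique hX dist_metric dist_lsc mu_moment hP mu_inv cf).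
move=> u /cP cu /(solP _ cu) fu; have [lu _] := cu.
have [U [U0 uN uU]] :=
  lip_norm_attained hX dist_metric (mlip_lip_norm dist_metric lu).
have uLf :=
  poisson_lip_norm hX dist_metric dist_lsc mu_moment hP mu_inv cf cu fu.
have pge0 : (0 <= p)%R by exact: le_trans hp.
have p00 : (0 <= p0)%R by exact: le_trans hp0.
split=> //.
- have two0 : (0 < 2 `^ p :> R)%R by exact: powR_gt0.
  apply/andP; split.
    rewrite -lee_pdivrMl//; apply: le_ereal_inf_tmp => _ [y _ <-].
    rewrite lee_pdivrMl// uN poweR_EFin.
    by apply: lip_moment_le => //; case: lu.
  have [x0 Ex0] := hEp.
  apply: lte_mul_pinfty => //.
  apply: le_lt_trans (ereal_inf_lbound _) _; first by exists x0.
  rewrite lte_add_pinfty ?ltry// uN poweR_EFin lte_mul_pinfty//.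
  by rewrite lee_fin powR_ge0.
- have := centered_moment_le dist_metric dist_lsc mu_moment p00 cu U0 uU.
  move=> /le_trans; apply; apply: lee_wpmul2r.
    by apply: integral_ge0 => x _; exact: poweR_ge0.
  have uN0 : 0 <= lip_norm dist u by rewrite uN lee_fin.
  rewrite -poweR_EFin -uN; apply: gt0_ler_poweR => //.
  + by rewrite in_itv/= uN0 leey.
  + by rewrite in_itv/= leey (le_trans uN0).
Qed.
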